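(* Let $p$ be a prime, $\Bbbk=\mathbb{Z}/p\mathbb{Z}$, let $G$ be a graph, and let $H$ be an induced subgraph of $G$. If $R_G$ is F-pure, then $R_H$ is F-pure.
   Context: Graphs are finite and simple. For a graph $G$ and a field $\Bbbk$, let $R=\Bbbk[x_v,y_v\mid v\in V(G)]$ and $f_{u,v}=x_uy_v-x_vy_u$. The binomial edge ideal of $G$ is $J_G=(f_{u,v}\mid \{u,v\}\in E(G))\subseteq R$, and $R_G=R/J_G$ (with $R_H$ defined in the same way using only the variables indexed by $V(H)$). A subgraph $H$ of $G$ is induced if every edge of $G$ with both endpoints in $V(H)$ is an edge of $H$. A ring $A$ of prime characteristic $p>0$ is F-pure if the Frobenius map $F:A\to F_*A$, $r\mapsto F_*r^p$, is a pure map of $A$-modules, i.e. $M\to M\otimes_A F_*A$ is injective for every $A$-module $M$. Here $F_*A$ is $A$ regarded as an $A$-module via $r\cdot F_*s=F_*(r^ps)$. *)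

(* Defs.v *)
From HB Require Import structures.
From mathcomp Require Import all_boot all_algebra.
From mathcomp Require Import boolp.
From mathcomp Require Import mpoly freeg.

Set Implicit Arguments.
Unset Strict Implicit.
Unset Printing Implicit Defensive.

Import GRing.Theory.
Local Open Scope ring_scope.
Local Open Scope quotient_scope.

(* Finite simple graphs whose vertices are drawn from a common finite ambient  *)
(* type T, so that graphs on different vertex sets can be compared.            *)
Record sgraph (T : finType) := SGraph {
  verts : {set T};
  adj : rel T;
  adj_verts : forall u v, adj u v -> (u \in verts) && (v \in verts);
  adj_sym : ssrbool.symmetric adj;
  adj_irrefl : irreflexive adj
}.

Definition subgraph (T : finType) (H G : sgraph T) : Prop :=
  verts H \subset verts G /\ forall u v, adj H u v -> adj G u v.

Definition induced_subgraph (T : finType) (H G : sgraph T) : Prop :=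
  subgraph H G /\
  forall u v, u \in verts H -> v \in verts H -> adj G u v -> adj H u v.

Definition vtx (T : finType) (G : sgraph T) : finType := {v : T | v \in verts G}.

Definition ideal_gen (R : comNzRingType) (I : finType) (P : pred I)
    (g : I -> R) : {pred R} :=
  fun x => `[< exists c : I -> R, x = \sum_(i | P i) c i * g i >].

Section BinomialEdgeIdeal.
Variables (k : fieldType) (T : finType) (G : sgraph T).

(* The variables are indexed by two disjoint copies of V(G): inl v is the      *)
(* index of x_v and inr v that of y_v.                                         *)
Definition edge_poly_ring := {mpoly k[#|{: vtx G + vtx G}|]}.

Definition xvar (v : vtx G) : edge_poly_ring := 'X_(enum_rank (inl v)).
Definition yvar (v : vtx G) : edge_poly_ring := 'X_(enum_rank (inr v)).

Definition edge_binomial (e : vtx G * vtx G) : edge_poly_ring :=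
  xvar e.1 * yvar e.2 - xvar e.2 * yvar e.1.

(* An edge {u,v} is met as both (u,v) and (v,u); the two binomials differ by a *)
(* sign.                                                                       *)
Definition binomial_edge_ideal : {pred edge_poly_ring} :=
  ideal_gen (fun e : vtx G * vtx G => adj G (val e.1) (val e.2)) edge_binomial.

Lemma binomial_edge_ideal_closed : idealr_closed binomial_edge_ideal.
Proof.
split.
- by apply/asboolP; exists (fun _ => 0); rewrite big1 // => i _; rewrite mul0r.
- apply/asboolP => -[c].
  move/(congr1 (mmap idfun (fun _ => 0 : k))); rewrite rmorph1 rmorph_sum big1.
    by move/eqP; rewrite oner_eq0.
  move=> e _ /=; rewrite rmorphM rmorphB !rmorphM /= /xvar /yvar.
  by rewrite !mmapX !mmap1U !mul0r subr0 mulr0.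
move=> a x y /asboolP[c ->] /asboolP[d ->]; apply/asboolP.
exists (fun e => a * c e + d e); rewrite mulr_sumr -big_split /=.
by apply: eq_bigr => e _; rewrite mulrDl mulrA.
Qed.

HB.instance Definition _ :=
  isIdealr.Build edge_poly_ring binomial_edge_ideal binomial_edge_ideal_closed.

Definition binomial_edge_ring : comNzRingType :=
  {ideal_quot binomial_edge_ideal}.

End BinomialEdgeIdeal.

Section Tensor.
Variables (A : comNzRingType) (M N : lmodType A).

Notation "<[ m , n ]>" := (<< (m, n) >> : {freeg (M * N) / int}).

Inductive tensor_null : {freeg (M * N) / int} -> Prop :=
| tensor_nullDl m1 m2 n :
    tensor_null (<[m1 + m2, n]> - <[m1, n]> - <[m2, n]>)
| tensor_nullDr m n1 n2 :
    tensor_null (<[m, n1 + n2]> - <[m, n1]> - <[m, n2]>)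
| tensor_nullZ a m n :
    tensor_null (<[a *: m, n]> - <[m, a *: n]>)
| tensor_null0 : tensor_null 0
| tensor_nullB z1 z2 :
    tensor_null z1 -> tensor_null z2 -> tensor_null (z1 - z2).

Definition tensor_kernel : {pred {freeg (M * N) / int}} :=
  fun z => `[< tensor_null z >].

Lemma tensor_kernel_closed : zmod_closed tensor_kernel.
Proof.
split=> [|x y /asboolP hx /asboolP hy]; apply/asboolP.
  exact: tensor_null0.
exact: tensor_nullB.
Qed.

HB.instance Definition _ :=
  GRing.isZmodClosed.Build {freeg (M * N) / int} tensor_kernel
    tensor_kernel_closed.

(* Only the underlying abelian group of the tensor product is needed to speak  *)
(* of injectivity, so its A-module structure is left out.                      *)
Definition tensor : zmodType := Quotient.quot tensor_kernel.

Definition tens (m : M) (n : N) : tensor :=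
  \pi_(Quotient.quot tensor_kernel) <[m, n]>.

End Tensor.

Section FrobeniusPushforward.
Variables (p : nat) (A : comNzRingType) (pA : p \in [pchar A]).

(* F_*A: the additive group A with r acting as multiplication by r ^+ p. It is *)
(* indexed by pA because distributivity over addition of scalars needs it.     *)
Definition Fpush : Type := (fun _ : p \in [pchar A] => A : Type) pA.

HB.instance Definition _ := GRing.Zmodule.on Fpush.

Definition Fpush_scale (r : A) (s : Fpush) : Fpush := r ^+ p * (s : A).

Fact Fpush_scaleA a b v :
  Fpush_scale a (Fpush_scale b v) = Fpush_scale (a * b) v.
Proof. by rewrite /Fpush_scale mulrA exprMn. Qed.

Fact Fpush_scale1 : left_id 1 Fpush_scale.
Proof. by move=> v; rewrite /Fpush_scale expr1n mul1r. Qed.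

Fact Fpush_scaleDr : right_distributive Fpush_scale +%R.
Proof. by move=> a u v; rewrite /Fpush_scale mulrDr. Qed.

Fact Fpush_scaleDl v : {morph Fpush_scale^~ v : a b / a + b}.
Proof.
move=> a b; rewrite /Fpush_scale.
by rewrite -!(pFrobenius_autE pA) rmorphD mulrDl.
Qed.

HB.instance Definition _ := GRing.Zmodule_isLmodule.Build A Fpush
  Fpush_scaleA Fpush_scale1 Fpush_scaleDr Fpush_scaleDl.

Definition frobenius (r : A^o) : Fpush := (r : A) ^+ p.

Fact frobenius_linear : linear frobenius.
Proof.
move=> a u v; rewrite /frobenius -(pFrobenius_autE pA) rmorphD rmorphM /=.
by rewrite !pFrobenius_autE.
Qed.

HB.instance Definition _ :=
  GRing.isLinear.Build A A^o Fpush *:%R frobenius frobenius_linear.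

End FrobeniusPushforward.

(* Under the identification of M with the tensor product of M and A, the map   *)
(* induced by an A-linear f : A -> N is m |-> m (x) f(1).                      *)
Definition pure_from_ring (A : comNzRingType) (N : lmodType A)
    (f : {linear A^o -> N}) : Prop :=
  forall M : lmodType A, injective (fun m : M => tens m (f 1)).

(* [pchar A] consists of primes, so p is prime here.                           *)
Definition F_pure (p : nat) (A : comNzRingType) : Prop :=
  exists pA : p \in [pchar A], pure_from_ring (frobenius pA).

(* Main.v *)
Require Import Defs.
From mathcomp Require Import all_boot all_algebra.
From HB Require Import structures.
From mathcomp Require Import boolp mpoly freeg.

Set Implicit Arguments.
Unset Strict Implicit.
Unset Printing Implicit Defensive.

Import GRing.Theory.
Local Open Scope ring_scope.
Local Open Scope quotient_scope.

(** The ring of H is an algebra retract of the ring of G. The inclusion of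
    variables respects the edge relations because every edge of H is an edge of
    G; in the other direction, setting x_v = y_v = 0 for v outside H kills the
    binomial of every edge with an endpoint outside H, and the remaining edges
    of G are edges of H because H is induced. Both maps come from the universal
    property [binomial_edge_ring_lift], and their composite on the ring of H is
    the identity because it fixes the generators ([binomial_edge_ring_ext]).

    F-purity descends along any ring retract r : B -> A of i : A -> B
    ([F_pure_retract]). Let M be an A-module, and view it as a B-module through
    r. Since r (i a) = a, the assignment m (x) s |-> m (x) i s is a well-defined
    additive map from M (x)_A F_*A to M (x)_B F_*B, and it sends m (x) 1 to
    m (x) 1. The map m |-> m (x) 1 into the target is injective as B is F-pure,
    hence so is the map m |-> m (x) 1 into the source. *)

(** * Balanced maps out of the tensor product *)

Section TensTheory.
Variables (A : comNzRingType) (M N : lmodType A).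

Lemma eq_tens (m m' : M) (n n' : N) :
  tens m n = tens m' n' <->
  tensor_null (<< (m, n) >> - << (m', n') >> : {freeg (M * N) / int}).
Proof.
rewrite /tens; split=> [/eqP|h].
  by rewrite -Quotient.idealrBE => /asboolP.
by apply/eqP; rewrite -Quotient.idealrBE; apply/asboolP.
Qed.

Lemma tensor_null_pi (z : {freeg (M * N) / int}) :
  tensor_null z -> \pi_(tensor M N) z = 0.
Proof.
move=> h; rewrite -[RHS](raddf0 (\pi_(tensor M N))).
by apply/eqP; rewrite -Quotient.idealrBE subr0; apply/asboolP.
Qed.

Lemma tensDl (m1 m2 : M) (n : N) : tens (m1 + m2) n = tens m1 n + tens m2 n.
Proof.
by apply/eqP; rewrite -subr_eq0 opprD addrA /tens -!raddfB;
  apply/eqP/tensor_null_pi/tensor_nullDl.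
Qed.

Lemma tensDr (m : M) (n1 n2 : N) : tens m (n1 + n2) = tens m n1 + tens m n2.
Proof.
by apply/eqP; rewrite -subr_eq0 opprD addrA /tens -!raddfB;
  apply/eqP/tensor_null_pi/tensor_nullDr.
Qed.

Lemma tensZ (a : A) (m : M) (n : N) : tens (a *: m) n = tens m (a *: n).
Proof. by apply/eq_tens/tensor_nullZ. Qed.

(** This is the part of the universal property of the tensor product that
    transports equalities of pure tensors: the map that b induces on the free
    group vanishes on the defining relations. *)
Lemma eq_tens_balanced (Z : zmodType) (b : M -> N -> Z) :
    (forall m1 m2 n, b (m1 + m2) n = b m1 n + b m2 n) ->
    (forall m n1 n2, b m (n1 + n2) = b m n1 + b m n2) ->
    (forall a m n, b (a *: m) n = b m (a *: n)) ->
  forall m m' n n', tens m n = tens m' n' -> b m n = b m' n'.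
Proof.
move=> bDl bDr bZ m m' n n' /eq_tens null.
pose B := fglift (R := int) (fun x : M * N => b x.1 x.2 : zmodule Z).
have BB : {morph B : x y / x - y} by exact: lift_is_additive.
have BE u v : B << (u, v) >> = b u v :> Z.
  rewrite /B liftU; exact: (@scale1r int (zmodule Z)).
have B0 z : tensor_null z -> B z = 0.
  elim=> [m1 m2 v|u n1 n2|a u v||z1 z2 _ h1 _ h2]; rewrite ?BB.
  - by rewrite !BE bDl addrAC addrK subrr.
  - by rewrite !BE bDr addrAC addrK subrr.
  - by rewrite !BE bZ subrr.
  - by rewrite -(subrr (0 : {freeg (M * N) / int})) BB subrr.
  - by rewrite h1 h2 subrr.
by apply/eqP; rewrite -subr_eq0 -!BE -[_ - _]BB (B0 _ null).
Qed.

End TensTheory.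

(** * Retracts of F-pure rings *)

(** The argument r tags the type, so that the B-module structure is inferred
    separately from the A-module structure carried by the same group M. *)
Definition restrict_scalars (A B : comNzRingType) (r : {rmorphism B -> A})
  (M : lmodType A) : Type := M.

Section RestrictScalars.
Variables (A B : comNzRingType) (r : {rmorphism B -> A}) (M : lmodType A).

HB.instance Definition _ := GRing.Zmodule.on (restrict_scalars r M).

Definition restrict_scale (b : B) (m : restrict_scalars r M) :
  restrict_scalars r M := r b *: (m : M).

Fact restrict_scaleA a b m :
  restrict_scale a (restrict_scale b m) = restrict_scale (a * b) m.
Proof. by rewrite /restrict_scale scalerA rmorphM. Qed.

Fact restrict_scale1 : left_id 1 restrict_scale.
Proof. by move=> m; rewrite /restrict_scale rmorph1 scale1r. Qed.

Fact restrict_scaleDr : right_distributive restrict_scale +%R.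
Proof. by move=> a m n; rewrite /restrict_scale scalerDr. Qed.

Fact restrict_scaleDl m : {morph restrict_scale^~ m : a b / a + b}.
Proof. by move=> a b; rewrite /restrict_scale rmorphD scalerDl. Qed.

HB.instance Definition _ := GRing.Zmodule_isLmodule.Build B
  (restrict_scalars r M)
  restrict_scaleA restrict_scale1 restrict_scaleDr restrict_scaleDl.

End RestrictScalars.

(** Purity of B is tested on the restriction of M along r, whose elements are
    those of M, rather than on the extension of M along i: the comparison map
    m (x) s |-> m (x) i s then carries m (x) 1 to m (x) 1, and an equality
    m (x) 1 = m' (x) 1 over A gives the same equality over B. *)
Lemma F_pure_retract (p : nat) (A B : comNzRingType)
    (i : {rmorphism A -> B}) (r : {rmorphism B -> A}) :
  cancel i r -> F_pure p B -> F_pure p A.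
Proof.
move=> iK [pB pureB]; have pA := rmorph_pchar r pB.
exists pA => M m m' eq_mm'; rewrite /= in eq_mm'.
apply: (pureB (restrict_scalars r M)).
have f1 (R : comNzRingType) (pR : p \in [pchar R]) : frobenius pR 1 = 1 :> R.
  exact: expr1n.
rewrite /= !f1; rewrite !f1 in eq_mm'.
pose b (u : M) (s : Fpush pA) : tensor (restrict_scalars r M) (Fpush pB) :=
  tens (u : restrict_scalars r M) (i s : Fpush pB).
suff: b m 1 = b m' 1 by rewrite /b rmorph1.
apply: (eq_tens_balanced _ _ _ eq_mm').
- by move=> *; exact: tensDl.
- by move=> u s t; rewrite /b -tensDr -rmorphD.
move=> a u s; rewrite /b.
(* The scalar a acts on M as i a does, since r (i a) = a; this is what lets it
   cross the tensor sign over B. *)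
have -> : (a *: u : restrict_scalars r M) = i a *: (u : restrict_scalars r M).
  by rewrite -[in LHS](iK a).
rewrite tensZ; congr tens.
by rewrite [RHS]rmorphM rmorphXn.
Qed.

(** * The universal property of the binomial edge ring *)

(** The induced map is evaluated on the chosen representative of a class; the
    choice does not matter because f vanishes on I. *)
Lemma ideal_quot_lift (R : comNzRingType) (I : idealr R) (S : comNzRingType)
    (f : {rmorphism R -> S}) :
    (forall x, x \in (I : pred R) -> f x = 0) ->
  exists g : {rmorphism {ideal_quot I} -> S},
    forall x, g (\pi_{ideal_quot I} x) = f x.
Proof.
move=> fI; pose g (q : {ideal_quot I}) := f (repr q).
have gE x : g (\pi x) = f x.
  apply/eqP; rewrite -subr_eq0 -rmorphB; apply/eqP/fI.
  by rewrite Quotient.idealrBE reprK.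
have gB : zmod_morphism g.
  by move=> x y; rewrite -[x]reprK -[y]reprK -rmorphB !gE rmorphB.
have gM : monoid_morphism g.
  split=> [|x y]; first by rewrite -(rmorph1 \pi) gE rmorph1.
  by rewrite -[x]reprK -[y]reprK -rmorphM !gE rmorphM.
pose gz := GRing.isZmodMorphism.Build _ _ g gB.
pose gm := GRing.isMonoidMorphism.Build _ _ g gM.
pose G : {rmorphism {ideal_quot I} -> S} := HB.pack g gz gm.
by exists G.
Qed.

Section UniversalProperty.
Variables (k : fieldType) (T : finType) (G : sgraph T).

Local Notation RG := (binomial_edge_ring k G).

Definition scalar_class (t : k) : RG := \pi_RG (t%:MP).
Definition x_class (v : vtx G) : RG := \pi_RG (xvar k v).
Definition y_class (v : vtx G) : RG := \pi_RG (yvar k v).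

HB.instance Definition _ := GRing.RMorphism.copy scalar_class
  (\pi_RG \o @mpolyC #|{: vtx G + vtx G}| k).

Lemma edge_relation (u v : vtx G) : adj G (val u) (val v) ->
  x_class u * y_class v = x_class v * y_class u.
Proof.
move=> uv; apply/eqP; rewrite /x_class /y_class -!rmorphM.
rewrite -Quotient.idealrBE; apply/asboolP.
exists (fun e => (e == (u, v))%:R).
rewrite (bigD1 (u, v)) //= eqxx mul1r big1 ?addr0 // => e /andP[_ /negPf ->].
by rewrite mul0r.
Qed.

Lemma binomial_edge_ring_lift (S : comNzRingType) (c : {rmorphism k -> S})
    (a b : vtx G -> S) :
    (forall u v, adj G (val u) (val v) -> a u * b v = a v * b u) ->
  exists g : {rmorphism RG -> S},
    [/\ forall t, g (scalar_class t) = c t,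
        forall v, g (x_class v) = a v & forall v, g (y_class v) = b v].
Proof.
move=> ab.
pose h (j : 'I_#|{: vtx G + vtx G}|) :=
  match enum_val j with inl v => a v | inr v => b v end.
have hx v : mmap c h (xvar k v) = a v.
  by rewrite mmapX mmap1U /h enum_rankK.
have hy v : mmap c h (yvar k v) = b v.
  by rewrite mmapX mmap1U /h enum_rankK.
have [|g gE] := @ideal_quot_lift _ (@binomial_edge_ideal k T G) S (mmap c h).
  move=> x /asboolP[d ->]; rewrite rmorph_sum big1 // => e adj_e.
  by rewrite rmorphM rmorphB !rmorphM /= !hx !hy ab // subrr mulr0.
by exists g; split=> [t|v|v]; rewrite gE /= (hx, hy, mmapC).
Qed.

(** The classes of scalars and variables generate the ring, so morphisms out of
    it are determined there. *)
Lemma binomial_edge_ring_ext (S : comNzRingType) (f g : {rmorphism RG -> S}) :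
    (forall t, f (scalar_class t) = g (scalar_class t)) ->
    (forall v, f (x_class v) = g (x_class v)) ->
    (forall v, f (y_class v) = g (y_class v)) ->
  f =1 g.
Proof.
move=> fgc fgx fgy q; rewrite -[q]reprK.
elim/mpolyind: (repr q) => [|t m P _ _ IH]; first by rewrite !rmorph0.
rewrite !rmorphD IH -mul_mpolyC !rmorphM [f _]fgc; congr (_ * _ + _).
rewrite mpolyXE_id !rmorph_prod; apply: eq_bigr => j _.
rewrite !rmorphXn; congr (_ ^+ _).
by rewrite -(enum_valK j); case: (enum_val j) => v; [exact: fgx | exact: fgy].
Qed.

End UniversalProperty.

(** The retraction sends the variables of the vertices outside H to 0. It
    respects the relation of an edge of G that lies inside H only because that
    edge is also an edge of H, which is where inducedness enters. *)
Lemma induced_retract (k : fieldType) (T : finType) (G H : sgraph T) :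
    induced_subgraph H G ->
  exists (i : {rmorphism binomial_edge_ring k H -> binomial_edge_ring k G})
         (r : {rmorphism binomial_edge_ring k G -> binomial_edge_ring k H}),
    cancel i r.
Proof.
move=> [[/subsetP sHG subHG] indHG].
pose up (v : vtx H) : vtx G := Sub (val v) (sHG _ (valP v)).
pose down (z : vtx H -> binomial_edge_ring k H) (v : vtx G) :=
  oapp z 0 (insub (val v)).
have downK z v : down z (up v) = z v.
  by rewrite /down SubK valK.
have [|i [ic ix iy]] := @binomial_edge_ring_lift k T H _
    (@scalar_class k T G) (@x_class k T G \o up) (@y_class k T G \o up).
  by move=> u v uv; apply: edge_relation; rewrite !SubK; exact: subHG.
have [|r [rc rx ry]] := @binomial_edge_ring_lift k T G _
    (@scalar_class k T H) (down (@x_class k T H)) (down (@y_class k T H)).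
  (* If u or v lies outside H then both sides contain a zero factor. *)
  move=> u v uv; rewrite /down.
  case: insubP => [u' uH eu|_]; case: insubP => [v' vH ev|_] /=;
    rewrite ?(mul0r, mulr0) //.
  by apply: edge_relation; apply: indHG; rewrite ?(eu, ev).
exists i, r => q.
have: r \o i =1 idfun; last exact.
apply: binomial_edge_ring_ext => [t|v|v] /=.
- by rewrite ic rc.
- by rewrite ix rx downK.
- by rewrite iy ry downK.
Qed.

Theorem lemma3p2 (p : nat) (hp : prime p) (T : finType) (G H : sgraph T)
    (hH : induced_subgraph H G) :
  F_pure p (binomial_edge_ring 'F_p G) -> F_pure p (binomial_edge_ring 'F_p H).
Proof.
by have [i [r ir]] := induced_retract 'F_p hH; exact: F_pure_retract ir.
Qed.
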